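(* For each admissible pair $(n,r)$ of positive integers, there exists a distance-preserving graph with $n$ vertices which is regular of degree $r$.
   Context: All graphs are finite, simple and connected. For a graph $G$, $d_G(u,v)$ denotes the distance between $u$ and $v$ in $G$ (the length of a shortest path). A subgraph $H$ of $G$ is isometric if $d_H(u,v)=d_G(u,v)$ for every $u,v\in V(H)$. A connected graph $G$ on $n$ vertices is distance-preserving (dp) if it contains at least one isometric subgraph with exactly $k$ vertices for every $k$ with $1\le k\le n$. A pair $(n,r)$ of positive integers is called admissible if $r\ge 3$, $n\ge r+1$, and, whenever $r$ is odd, $n$ is even. *)

(* Defs.v *)
From mathcomp Require Import all_boot.

Set Implicit Arguments.
Unset Strict Implicit.
Unset Printing Implicit Defensive.

(* Finite, simple, connected graphs. *)
Record graph := Graph {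
  vertex :> finType;
  adj : rel vertex;
  adj_sym : symmetric adj;
  adj_irr : irreflexive adj;
  adj_connected : forall u v, connect adj u v
}.

(* An arbitrary, not necessarily induced, connected subgraph. Its edge relation
   lives on the vertices of G but only relates elements of sub_vertex. *)
Record subgraph (G : graph) := Subgraph {
  sub_vertex : {set G};
  sub_adj : rel G;
  sub_adj_sym : symmetric sub_adj;
  sub_adjP : forall u v, sub_adj u v ->
    [/\ u \in sub_vertex, v \in sub_vertex & adj u v];
  sub_connected : {in sub_vertex &, forall u v, connect sub_adj u v}
}.

Definition has_path (T : finType) (e : rel T) (u v : T) (k : nat) : bool :=
  [exists p : k.-tuple T, [&& path e u p, uniq (u :: p) & last u p == v]].

(* The least k with has_path e u v k; a path has fewer than #|T| edges, so the
   value is #|T| exactly when v is not reachable from u. *)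
Definition dist (T : finType) (e : rel T) (u v : T) : nat :=
  find (has_path e u v) (iota 0 #|T|).

Definition isometric (G : graph) (H : subgraph G) : Prop :=
  {in sub_vertex H &, forall u v, dist (@sub_adj G H) u v = dist (@adj G) u v}.

Definition distance_preserving (G : graph) : Prop :=
  forall k, 1 <= k <= #|G| ->
    exists H : subgraph G, #|sub_vertex H| = k /\ isometric H.

Definition regular (G : graph) (r : nat) : Prop :=
  forall v : G, #|[set w | adj v w]| = r.

Definition admissible (n r : nat) : Prop :=
  [/\ 0 < n, 0 < r, 3 <= r, r + 1 <= n & (odd r -> ~~ odd n)].

(* Main.v *)
Require Import Defs.
From mathcomp Require Import all_boot.
From mathcomp Require Import zify.

Set Implicit Arguments.
Unset Strict Implicit.
Unset Printing Implicit Defensive.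

(** Deleting a vertex v from an isometric vertex set leaves an isometric set as
    soon as any two nonadjacent neighbours of v have another common neighbour
    in what remains: a geodesic through v can then be rerouted at the same
    length. So a graph is distance-preserving if its vertices can be added one
    at a time, each new vertex having an earlier neighbour and any two of its
    nonadjacent earlier neighbours sharing an earlier neighbour. Such graphs are
    called buildable ([buildable_realizable]); it remains to exhibit a
    buildable r-regular graph on n vertices for every admissible pair.

    The main source is the layered graphs: layers of sizes a_1, ..., a_m,
    consecutive layers completely joined, and inside layer i a circulant graph
    of the degree r - a_(i-1) - a_(i+1) that makes the whole graph r-regular.
    Adding the vertices layer by layer shows that they are buildable, whatever
    the layers look like inside ([layered_realizable]). The construction is
    thereby reduced to finding sequences of sizes with a given sum that satisfy
    a local inequality and a local parity condition ([balanced]):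
    - r, n - r when n <= 2r;
    - y, (r-1, 1, 1)^(k+1), r-1, y' for odd r, where y and y' are even;
    - y, (r-2, 1, 2)^(k+1), t with three possible ends t, for even r >= 6.
    One period of the repeated block has r + 1 vertices, and the free ends reach
    every residue modulo r + 1 (every even one when r is odd).

    Two values of n escape layered graphs for every r: with at most four layers
    n <= 2r, and with more the first two layers and the last two take at least
    r + 1 vertices each and do not exhaust the graph. For n = 2r + 2 one takes
    K_(r+1,r+1) minus a perfect matching ([crown_realizable]). For n = 2r + 1,
    with r even, one matches a clique on r vertices with K_r minus a perfect
    matching and cones off the latter ([cone_realizable]). For r = 3 and r = 4 the ends leave
    too little room; other layer sequences are used there, and four small graphs
    are given by explicit lists ([cubic_realizable], [quartic_realizable]). *)

(** * Distances and lengths of walks *)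

Definition restrict (T : finType) (e : rel T) (S : {set T}) : rel T :=
  fun x y => [&& x \in S, y \in S & e x y].

(** The distance is the length of a shortest simple path; loop removal makes
    arbitrary walks equally good, so simplicity never has to be tracked. The
    bound on k sets aside the value given to unreachable vertices. *)
Lemma dist_leP (T : finType) (e : rel T) (u v : T) (k : nat) :
  k < #|T| ->
  (dist e u v <= k <-> exists p, [/\ path e u p, last u p = v & size p <= k]).
Proof.
move=> kT; split.
  rewrite /dist => dk.
  have hs : has (has_path e u v) (iota 0 #|T|).
    by rewrite has_find size_iota; apply: leq_ltn_trans kT.
  have := nth_find 0 hs; rewrite nth_iota; last first.
    by apply: leq_ltn_trans kT.
  rewrite add0n => /existsP [p /and3P [pp _ /eqP lp]].
  by exists p; split; rewrite ?size_tuple.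
move=> [p [pp lp sp]]; move: lp; case/shortenP: pp => q qq uq sub lq.
have sq : size q <= k.
  apply: leq_trans sp; apply: uniq_leq_size => //.
  by case/andP: uq.
have hq : has_path e u v (size q).
  by apply/existsP; exists (in_tuple q); rewrite qq uq lq eqxx.
apply: leq_trans sq; rewrite leqNgt; apply/negP => lt_q.
have := before_find 0 lt_q; rewrite nth_iota ?add0n ?hq //.
by apply: leq_trans lt_q _; rewrite -[X in _ <= X](size_iota 0); apply: find_size.
Qed.

Lemma dist_mono (T : finType) (e1 e2 : rel T) (u v : T) :
  (forall p, path e1 u p -> last u p = v ->
     exists q, [/\ path e2 u q, last u q = v & size q <= size p]) ->
  dist e2 u v <= dist e1 u v.
Proof.
move=> H; have [big|small] := leqP #|T| (dist e1 u v).
  apply: leq_trans big; rewrite -[X in _ <= X](size_iota 0).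
  exact: find_size.
apply/dist_leP => //.
have /dist_leP [] : dist e1 u v <= dist e1 u v by [].
  by [].
move=> p [pp lp sp]; have [q [qq lq sq]] := H p pp lp.
by exists q; split => //; apply: leq_trans sp.
Qed.

(** * Building a graph vertex by vertex *)

Definition realizable (n r : nat) : Prop :=
  exists G : graph, [/\ #|G| = n, distance_preserving G & regular G r].

Section Buildable.
Variables (T : finType) (e : rel T).
Hypotheses (e_sym : symmetric e) (e_irr : irreflexive e).
Implicit Types S : {set T}.

(** Isometry of the subgraph induced by S, phrased by transforming walks so
    that distances need not be computed; it also contains connectedness when e
    is connected. *)
Definition isometric_set S := forall u v p, u \in S -> v \in S ->
  path e u p -> last u p = v ->
  exists q, [/\ path (restrict e S) u q, last u q = v & size q <= size p].

Definition attachable S v : Prop :=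
  (exists2 u, u \in S & e v u) /\
  {in S &, forall x y, e v x -> e v y -> x != y -> ~~ e x y ->
     exists2 z, z \in S & e x z && e z y}.

(** Recording the sets that arise, rather than an enumeration of the vertices,
    leaves the order of addition open where it does not matter. *)
Inductive buildable : {set T} -> Prop :=
| buildable1 x : buildable [set x]
| buildableU S v : buildable S -> v \notin S -> attachable S v ->
    buildable (v |: S).

(** A walk that leaves S does so through v only, in a detour a, v, y with a and
    y in S. The detour is shortened when a and y are equal or adjacent, and
    otherwise replaced by a, z, y with z a common neighbour in S. *)
Lemma isometric_setU1 S v : v \notin S -> attachable S v ->
  isometric_set (v |: S) -> isometric_set S.
Proof.
move=> vS [_ att] iso u w p uS wS pp lp.
have [||q [qq lq sq]] := iso u w p _ _ pp lp; rewrite ?inE ?uS ?wS ?orbT //.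
suff [q' [q'q lq' sq']] : exists q', [/\ path (restrict e S) u q',
    last u q' = w & size q' <= size q].
  by exists q'; split => //; apply: leq_trans sq.
elim: {q}(size q) {-2}q (leqnn (size q)) u uS qq lq {pp lp sq p}; last first.
  move=> n IH [|a q] /= sq u uS; first by move=> _ <-; exists [::].
  case/andP=> /and3P [_ aSv ua] qq lq.
  have [aS|aS] := boolP (a \in S).
    have [q' [h1 h2 h3]] := IH q sq a aS qq lq.
    by exists (a :: q'); split => //=; rewrite /restrict uS aS ua.
  have {aSv aS} av : a = v by move: aSv; rewrite !inE (negPf aS) orbF => /eqP.
  subst a; case: q sq qq lq => [|y q] /= sq.
    by move=> _ vw; rewrite vw wS in vS.
  case/andP=> /and3P [_ ySv vy] qq lq.
  have yS : y \in S.
    by move: ySv; rewrite !inE => /orP [/eqP yv|//]; rewrite yv e_irr in vy.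
  have [|q' [h1 h2 h3]] := IH q _ y yS qq lq; first exact: ltnW.
  have [uy|uy] := eqVneq u y.
    by exists q'; rewrite uy; split => //; apply: leq_trans h3 _; rewrite leqW.
  have [euy|euy] := boolP (e u y).
    exists (y :: q'); split => //=; last by rewrite ltnS (leq_trans h3).
    by rewrite /restrict uS yS euy.
  rewrite e_sym in ua.
  have [z zS /andP [uz zy]] := att u y uS yS ua vy uy euy.
  exists [:: z, y & q']; split => //=.
  by rewrite /restrict uS yS zS uz zy.
by case=> //= _ u uS _ <-; exists [::].
Qed.

(** Used to add a whole block of vertices in any order: the condition is asked
    of every set that may have been reached inside the block. *)
Lemma buildable_grow S0 S1 : buildable S0 -> S0 \subset S1 ->
  (forall S v, S0 \subset S -> S \subset S1 -> v \in S1 -> v \notin S ->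
     attachable S v) -> buildable S1.
Proof.
move=> b0.
elim: {S0}_.+1 {-2}S0 (ltnSn #|S1 :\: S0|) b0 => // n IH S0 sz b0 s01 H.
have [s10|/subsetPn [v v1 v0]] := boolP (S1 \subset S0).
  by have -> : S1 = S0 by apply/eqP; rewrite eqEsubset s10.
have sv : v |: S0 \subset S1 by rewrite subUset sub1set v1.
apply: (IH (v |: S0)) => //.
- rewrite (cardsD1 v) !inE v1 v0 /= in sz.
  suff -> : S1 :\: (v |: S0) = (S1 :\: S0) :\ v by [].
  by apply/setP => x; rewrite !inE negb_or andbA.
- by apply: buildableU => //; apply: H.
- move=> S w sS; apply: H; exact: subset_trans (subsetUr _ _) sS.
Qed.

Lemma buildable_connect S : buildable S ->
  {in S &, forall u v, connect e u v}.
Proof.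
elim=> [x u v|{}S v _ IH vS [[u0 u0S vu0] _] x y].
  by rewrite !inE => /eqP-> /eqP->; apply: connect0.
have cv z : z \in S -> connect e v z.
  by move=> zS; apply: connect_trans (IH _ _ u0S zS); apply: connect1.
have csym := sym_connect_sym e_sym.
rewrite !inE => /orP [/eqP->|xS] /orP [/eqP->|yS] //.
- exact: cv.
- by rewrite csym cv.
- exact: IH.
Qed.

(** Isometry descends from the full vertex set along the construction, whose
    stages take all cardinalities. *)
Lemma buildable_subset S k : buildable S -> isometric_set S -> 0 < k <= #|S| ->
  exists2 S' : {set T}, #|S'| = k & isometric_set S'.
Proof.
elim=> [x|{}S v _ IH vS att] iso.
  rewrite cards1; case: k => [|[|k]] // _.
  by exists [set x]; rewrite ?cards1.
rewrite cardsU1 vS => /andP [k0]; rewrite leq_eqVlt => /orP [/eqP->|kS].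
  by exists (v |: S); rewrite ?cardsU1 ?vS.
by apply: IH; [exact: isometric_setU1 att iso | rewrite k0 -ltnS].
Qed.

Lemma buildable_realizable r : buildable setT ->
  (forall v, #|[set w | e v w]| = r) -> realizable #|T| r.
Proof.
move=> b deg; have conn u v : connect e u v.
  exact: (buildable_connect b (in_setT u) (in_setT v)).
exists (Graph e_sym e_irr conn); split => // k kT; rewrite -cardsT in kT.
have isoT : isometric_set setT.
  move=> u v p _ _ pp lp; exists p; split=> //.
  by rewrite (eq_path (e' := e)) // => x y; rewrite /restrict !inE.
have [S cS iso] := buildable_subset b isoT kT.
have rsym : symmetric (restrict e S).
  by move=> x y; rewrite /restrict e_sym andbCA.
have rP u v : restrict e S u v -> [/\ u \in S, v \in S & e u v].
  by case/and3P.
have rconn : {in S &, forall u v, connect (restrict e S) u v}.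
  move=> u v uS vS; have /connectP [p pp lp] := conn u v.
  have [q [qq lq _]] := iso u v p uS vS pp (esym lp).
  by apply/connectP; exists q.
exists (@Subgraph (Graph e_sym e_irr conn) S _ rsym rP rconn); split=> //.
move=> u v /= uS vS; apply/eqP; rewrite eqn_leq; apply/andP; split.
  by apply: dist_mono => p pp lp; apply: iso.
apply: dist_mono => p pp lp; exists p; split => //.
by apply: sub_path pp => x y /and3P [].
Qed.

End Buildable.

(** * Circulant graphs *)

Section Circulant.
Variables (c d : nat).
Hypotheses (ltdc : d < c) (cd_even : ~~ odd (c * d)).

(** The connection set: the d residues closest to c / 2, which is symmetric
    under negation and avoids 0. When d is even the residue c / 2 itself, being
    its own opposite, must be left out; when d is odd it is kept, and c is even
    by the parity hypothesis. *)
Definition central (j : nat) : bool :=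
  [&& c - d <= j.*2, j.*2 <= c + d & odd d || (j.*2 != c)].

Definition circulant : rel 'I_c := fun x y => central ((y + (c - x)) %% c).

Lemma circulantE (x y : 'I_c) :
  circulant x y = central (if x <= y then y - x else c + y - x).
Proof.
rewrite /circulant; congr central; case: x y => x hx [y hy] /=.
have [xy|xy] := leqP x y.
  have -> : y + (c - x) = (y - x) + c by lia.
  by rewrite modnDr modn_small //; lia.
by rewrite modn_small; lia.
Qed.

Lemma circulant_sym : symmetric circulant.
Proof.
move=> x y; rewrite !circulantE /central.
have hx := ltn_ord x; have hy := ltn_ord y.
case: (ltngtP x y) => xy; apply/and3P/and3P => -[h1 h2 h3]; split; lia.
Qed.

Lemma circulant_irr : irreflexive circulant.
Proof.
move=> x; rewrite circulantE leqnn subnn /central.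
by apply/negP => /and3P []; lia.
Qed.

(** The bracket corrects for the midpoint, which lies in the counted interval
    but not in the connection set when c and d are even. *)
Lemma count_central n :
  \sum_(0 <= j < n | central j) 1 + [&& ~~ odd d, ~~ odd c & c./2 < n] =
  minn n (c + d)./2.+1 - (c - d).+1./2.
Proof.
elim: n => [|n IH]; first by rewrite big_nil andbF; lia.
have [h|h] := boolP (central n).
  rewrite big_mkcond big_nat_recr //= -big_mkcond h.
  move: h => /and3P [h1 h2 h3].
  case od : (odd d) IH h3 => /=; case oc : (odd c) => /=; lia.
rewrite big_mkcond big_nat_recr //= -big_mkcond (negPf h).
move: h; rewrite {1}/central.
case od : (odd d) IH => /=; case oc : (odd c) => /= ; lia.
Qed.

Lemma circulant_regular (x : 'I_c) : #|[set y | circulant x y]| = d.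
Proof.
have c0 : 0 < c by lia.
pose f (y : 'I_c) : 'I_c := Ordinal (ltn_pmod (y + (c - x)) c0).
have f_inj : injective f.
  move=> y z /(congr1 val) /= /eqP; rewrite eqn_modDr => /eqP.
  by rewrite !modn_small // => /val_inj.
have -> : [set y | circulant x y] = f @^-1: [set j : 'I_c | central j].
  by apply/setP => y; rewrite !inE.
rewrite on_card_preimset; last exact/onW_bij/injF_bij.
rewrite -sum1dep_card -(big_mkord (fun j => central j) (fun=> 1)).
have := count_central c; move: cd_even; rewrite oddM.
case od : (odd d); case oc : (odd c) => //=; lia.
Qed.
End Circulant.

(** * Layered graphs *)

Section Levels.
Variables (T : finType) (e : rel T) (level : T -> nat) (top : nat).
Hypothesis top_gt0 : 0 < top.
Hypothesis level_le : forall x, level x <= top.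
Hypothesis level_onto : forall i, i <= top -> exists x, level x = i.
Hypothesis adj_next : forall x y,
  (level x == (level y).+1) || (level y == (level x).+1) -> e x y.
Hypothesis adj_near : forall x y, e x y ->
  level y <= (level x).+1 /\ level x <= (level y).+1.

(** A vertex w of level 1 is added first, so that any two vertices of level 0
    have a common neighbour from the start. Then the levels are filled in
    increasing order: the neighbours of a new vertex of level i + 1 lie in the
    levels i and i + 1, two of them on different levels are adjacent, and two on
    the same level have a common neighbour on level i (for i + 1) or on level
    i - 1 (for i, with w serving when i = 0). *)
Lemma levels_buildable : buildable e setT.
Proof.
have [w w1] := level_onto top_gt0.
have [a a0] := level_onto (leq0n _).
pose upto i := w |: [set x | level x <= i].
suff build i : i <= top -> buildable e (upto i).
  have -> : setT = upto top; last exact: build.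
  by apply/setP => x; rewrite !inE level_le orbT.
elim: i => [_|i IH it].
  apply: (buildable_grow (buildable1 e w)).
    by rewrite sub1set !inE eqxx.
  move=> S v wS SS vU vS; have {}wS : w \in S by rewrite -sub1set.
  have v0 : level v = 0.
    move: vU; rewrite !inE leqn0 => /orP [/eqP vw|/eqP //].
    by rewrite vw wS in vS.
  have lev x : x \in S -> x != w -> level x = 0.
    by move=> /(subsetP SS); rewrite !inE leqn0 => /orP [->//|/eqP].
  split; first by exists w => //; apply: adj_next; rewrite v0 w1.
  move=> x y xS yS _ _ xy exy; exists w => //.
  have [xw|xw] := eqVneq x w.
    case/negP: exy; apply: adj_next; rewrite xw w1 (lev y) //.
    by rewrite -xw eq_sym.
  have [yw|yw] := eqVneq y w.
    by case/negP: exy; apply: adj_next; rewrite yw w1 (lev x).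
  by rewrite !adj_next // w1 lev.
have [t ti] := level_onto (ltnW it).
apply: (buildable_grow (IH (ltnW it))).
  by apply/subsetP => x; rewrite !inE => /orP [->//|/leqW ->]; rewrite orbT.
move=> S v US SS vU vS.
have inS x : level x <= i -> x \in S.
  by move=> xi; apply: (subsetP US); rewrite !inE xi orbT.
have wS : w \in S by apply: (subsetP US); rewrite !inE eqxx.
have le x : x \in upto i.+1 -> level x <= i.+1.
  by rewrite !inE => /orP [/eqP ->|//]; rewrite w1.
have vi : level v = i.+1.
  apply/eqP; rewrite eqn_leq le //= ltnNge.
  by apply: contra vS => /inS.
have tS : t \in S by apply: inS; rewrite ti.
split; first by exists t => //; apply: adj_next; rewrite vi ti eqxx.
move=> x y xS yS vx vy xy exy.
have := adj_near vx; have := adj_near vy.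
have := le x (subsetP SS _ xS); have := le y (subsetP SS _ yS).
have : ~~ ((level x == (level y).+1) || (level y == (level x).+1)).
  by apply: contra exy => /adj_next.
rewrite vi => nxy ly lx [_ ly'] [_ lx'].
have lxy : level x = level y by move: nxy ly lx ly' lx'; clear; lia.
have [xi|xi] := eqVneq (level x) i.+1.
  by exists t => //; rewrite !adj_next // ti -?lxy xi eqxx ?orbT.
have {}xi : level x = i by move: xi lx lx'; clear; lia.
have [z zS zi] : exists2 z, z \in S & (i == (level z).+1) || (level z == i.+1).
  case: (posnP i) => [i0|i0]; first by exists w => //; rewrite w1 i0 orbT.
  have [|z zi] := @level_onto i.-1; first by move: it i0; clear; lia.
  exists z; first by apply: inS; rewrite zi leq_pred.
  by rewrite zi prednK // eqxx.
by exists z => //; rewrite !adj_next // -?lxy xi ?zi // orbC.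
Qed.
End Levels.

(** The condition on the layer sizes s, preceded by a layer of size p, under
    which a layer of size c between layers of total size b can carry a regular
    graph of the missing degree r - b. *)
Fixpoint balanced (r p : nat) (s : seq nat) : bool :=
  if s is c :: s' then
    let b := p + head 0 s' in
    [&& b <= r, r - b < c, ~~ odd (c * (r - b)) & balanced r c s']
  else true.

Lemma balanced_nth r p s i : balanced r p s -> i < size s ->
  let b := nth 0 (p :: s) i + nth 0 s i.+1 in
  [/\ b <= r, r - b < nth 0 s i & ~~ odd (nth 0 s i * (r - b))].
Proof.
elim: s p i => //= c s IH p [|i] /and4P [h1 h2 h3 h4]; first by rewrite nth0.
by move=> si; apply: (IH c i h4 si).
Qed.

Lemma sum_pick (F : nat -> nat) m k :
  \sum_(j < m) (j == k :> nat) * F j = if k < m then F k else 0.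
Proof.
elim: m => [|m IH]; first by rewrite big_ord0.
rewrite big_ord_recr /= IH ltnS.
have [->|nmk] := eqVneq m k; first by rewrite ltnn leqnn mul1n.
by rewrite mul0n addn0 [k <= m]leq_eqVlt eq_sym (negPf nmk).
Qed.

Section Layers.
Variables (r : nat) (s : seq nat).
Hypotheses (s_big : 1 < size s) (s_bal : balanced r 0 s).

Let vtx := {i : 'I_(size s) & 'I_(nth 0 s i)}.
Let valency i := r - (nth 0 (0 :: s) i + nth 0 s i.+1).

Definition layer_adj : rel vtx := fun x y =>
  if tag x == tag y then circulant (valency (tag x)) (tagged x) (tagged_as x y)
  else (tag x == (tag y).+1 :> nat) || (tag y == (tag x).+1 :> nat).

Let valencyP (i : 'I_(size s)) :
  valency i < nth 0 s i /\ ~~ odd (nth 0 s i * valency i).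
Proof. by have [] := balanced_nth s_bal (ltn_ord i). Qed.

Lemma layer_adj_sym : symmetric layer_adj.
Proof.
move=> [i x] [j y]; rewrite /layer_adj /= [j == i]eq_sym.
case: eqVneq => [ij|_]; last by rewrite orbC.
subst j; rewrite !tagged_asE; have [h1 h2] := valencyP i.
exact: circulant_sym.
Qed.

Lemma layer_adj_irr : irreflexive layer_adj.
Proof.
move=> [i x]; rewrite /layer_adj /= eqxx tagged_asE.
by have [h1 h2] := valencyP i; apply: circulant_irr.
Qed.

Lemma layer_buildable : buildable layer_adj setT.
Proof.
apply: (@levels_buildable _ _ (fun x : vtx => tag x) (size s).-1).
- lia.
- by move=> x /=; rewrite -ltnS prednK ?(ltnW s_big).
- move=> i hi; have si : i < size s.
    by rewrite -(prednK (ltnW s_big)) ltnS.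
  have [h _] := valencyP (Ordinal si).
  have x0 := Ordinal (leq_ltn_trans (leq0n _) h).
  by exists (existT (fun j : 'I_(size s) => 'I_(nth 0 s j)) (Ordinal si) x0).
- move=> x y h; rewrite /layer_adj; case: eqP => // xy; exfalso.
  by move: h => /=; rewrite xy; rewrite (ltn_eqF (ltnSn _)).
- move=> x y; rewrite /layer_adj; case: eqP => [xy _|_]; first by rewrite xy leqnSn.
  case/orP => /eqP ->; rewrite ?leqnSn ?leqnn; split => //.
    by apply: leqW; rewrite leqW.
  by apply: leqW; rewrite leqW.
Qed.

Lemma card_layers : #|{: vtx}| = sumn s.
Proof.
rewrite card_tagged [in RHS]sumnE (big_nth 0) big_mkord sumnE big_map big_enum /=.
by apply: eq_bigr => i _; rewrite card_ord.
Qed.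

Lemma layer_regular v : #|[set w | layer_adj v w]| = r.
Proof.
case: v => i x; rewrite -sum1dep_card.
have -> : \sum_(w : vtx | layer_adj (existT _ i x) w) 1 =
    \sum_(j < size s)
      \sum_(y < nth 0 s j | layer_adj (existT _ i x) (existT _ j y)) 1.
  by rewrite sig_big_dep /=; apply: eq_bigl => -[].
(* A vertex of layer i meets layer j in its valency, all of it, or nothing. *)
rewrite (eq_bigr (fun j : 'I_(size s) => (j == i :> nat) * valency j +
    ((j == i.-1 :> nat) * ((0 < i) * nth 0 s j) +
     (j == i.+1 :> nat) * nth 0 s j))); last first.
  move=> j _; rewrite sum1dep_card /layer_adj /=.
  case: eqVneq => [ij|ij].
    subst j; rewrite eqxx.
    have [h1 h2] := valencyP i.
    rewrite (eq_card (B := [set y | circulant (valency i) x y])); last first.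
      by move=> y; rewrite !inE tagged_asE.
    rewrite circulant_regular //; lia.
  have nij : (j == i :> nat) = false by apply/negbTE; rewrite eq_sym.
  rewrite nij mul0n add0n.
  (* The factor 0 < i matters because the predecessor of 0 is 0. *)
  have -> : (i == j.+1 :> nat) || (j == i.+1 :> nat) =
     (j == i.-1 :> nat) && (0 < i) || (j == i.+1 :> nat) by lia.
  have : ~~ ((j == i.-1 :> nat) && (0 < i) && (j == i.+1 :> nat)) by lia.
  case: (_ && (0 < i)) (mulnb (j == i.-1 :> nat) (0 < i)) => /= hm.
    move=> /negbTE ->; rewrite mulnA hm mul1n addn0.
    by rewrite (eq_card (B := predT)) ?card_ord // => y; rewrite !inE.
  move=> _; rewrite mulnA hm mul0n add0n; case: (_ == _).
    by rewrite (eq_card (B := predT)) ?card_ord ?mul1n // => y; rewrite !inE.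
  by rewrite mul0n (eq_card (B := pred0)) ?card0 // => y; rewrite !inE.
rewrite !big_split /=.
rewrite (sum_pick valency) (sum_pick (fun j => (0 < i) * nth 0 s j)).
rewrite (sum_pick (nth 0 s)) ltn_ord.
have [h _ _] := balanced_nth s_bal (ltn_ord i).
have e2 : (if i.+1 < size s then nth 0 s i.+1 else 0) = nth 0 s i.+1.
  by case: ltnP => // hs; rewrite nth_default.
have e1 : (if i.-1 < size s then (0 < i) * nth 0 s i.-1 else 0) = nth 0 (0 :: s) i.
  rewrite (leq_ltn_trans (leq_pred i)) ?ltn_ord //.
  by case: (nat_of_ord i) => [|k] //=; rewrite mul1n.
by rewrite e1 e2 /valency subnK.
Qed.
End Layers.

Lemma layered_realizable r s :
  1 < size s -> balanced r 0 s -> realizable (sumn s) r.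
Proof.
move=> s1 sb; rewrite -(card_layers s).
apply: (buildable_realizable (layer_adj_sym sb) (layer_adj_irr sb)).
  exact: layer_buildable.
exact: layer_regular.
Qed.

(** * The crown graph, with 2r + 2 vertices *)

Section Crown.
Variable m : nat.

Definition crown_adj : rel (bool * 'I_m.+4) :=
  fun x y => (x.1 != y.1) && (x.2 != y.2).

Lemma crown_sym : symmetric crown_adj.
Proof. by move=> x y; rewrite /crown_adj ![y.1 == _]eq_sym ![y.2 == _]eq_sym. Qed.

Lemma crown_irr : irreflexive crown_adj.
Proof. by move=> x; rewrite /crown_adj eqxx. Qed.

(** One vertex (false, 0) and its neighbours form a star; any further vertex
    then has its neighbours inside that star, joined through the centre. The
    last vertex (true, 0) is not adjacent to the centre, and two of its
    neighbours (false, i) and (false, j) are joined through (true, k) with k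
    different from 0, i and j: this is where at least four indices are needed.
    *)
Lemma crown_buildable : buildable crown_adj setT.
Proof.
pose b0 : bool * 'I_m.+4 := (false, ord0).
pose a i : bool * 'I_m.+4 := (true, i).
pose star := b0 |: [set x : bool * 'I_m.+4 | x.1 && (x.2 != ord0)].
have star_build : buildable crown_adj star.
  apply: (buildable_grow (buildable1 _ b0)).
    by rewrite sub1set !inE eqxx.
  move=> S v bS SS vU vS; have {}bS : b0 \in S by rewrite -sub1set.
  have [v1 v2] : v.1 /\ v.2 != ord0.
    by move: vU; rewrite !inE => /orP [/eqP vb|/andP//]; rewrite vb bS in vS.
  split; first by exists b0 => //; rewrite /crown_adj v1.
  have adj x : x \in S -> crown_adj v x -> x = b0.
    move=> /(subsetP SS); rewrite !inE => /orP [/eqP//|/andP [x1 x2]].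
    by rewrite /crown_adj v1 x1.
  by move=> x y xS yS /(adj _ xS) -> /(adj _ yS) ->; rewrite eqxx.
pose most := [set~ a ord0].
have most_build : buildable crown_adj most.
  apply: (buildable_grow star_build).
    apply/subsetP => -[x1 x2]; rewrite !inE => /orP [/eqP->//|/= /andP [x1T x20]].
    by rewrite /a xpair_eqE negb_and x20 orbT.
  move=> S v sS SS vU vS.
  have bS : b0 \in S by apply: (subsetP sS); rewrite !inE eqxx.
  have aS i : i != ord0 -> a i \in S.
    by move=> i0; apply: (subsetP sS); rewrite !inE /= i0.
  case: v vU vS => [[] i] vU vS.
    by move: vU; rewrite !inE /a xpair_eqE /= => /aS; rewrite (negPf vS).
  have [j jP] : exists j : 'I_m.+4, (j != ord0) && (j != i).
    exists (if i == inord 1 then inord 2 else inord 1).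
    have [->|h] := eqVneq i (inord 1); first by rewrite -!val_eqE /= !inordK.
    by rewrite [inord 1 == i]eq_sym h -val_eqE /= inordK.
  have /andP [j0 ji] := jP.
  split; first by exists (a j); [exact: aS | rewrite /crown_adj /= eq_sym].
  have adj x : x \in S -> crown_adj (false, i) x -> crown_adj x b0.
    case: x => [x1 x2] /(subsetP SS).
    by rewrite !inE /a xpair_eqE /crown_adj /= => + /andP [+ _]; case: x1.
  move=> x y xS yS /(adj _ xS) xb /(adj _ yS) yb _ _.
  by exists b0; rewrite // xb crown_sym.
apply: (buildable_grow most_build); first exact: subsetT.
move=> S v mS _ _ vS.
have inS x : x != a ord0 -> x \in S.
  by move=> xa; apply: (subsetP mS); rewrite !inE.
have va : v = a ord0 by apply/eqP; apply: contraNT vS; apply: inS.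
subst v; split.
  by exists (false, inord 1); rewrite ?inS // /crown_adj -val_eqE /= inordK.
move=> [x1 i] [y1 j] _ _; rewrite /crown_adj /=.
case: x1 => //= i0; case: y1 => //= j0 _ _.
have [k] : exists k : 'I_m.+4, [&& k != ord0, k != i & k != j].
  have : 0 < #|~: [set ord0; i; j]|.
    have := cardsC [set ord0; i; j]; rewrite card_ord.
    have [+ _] := leq_card_setU [set ord0; i] [set j]; rewrite cards2 cards1.
    move: #|_ :|: _| #|~: _| => p q.
    by case: (_ != i) => /=; lia.
  by case/card_gt0P => k; rewrite !inE !negb_or -andbA; exists k.
case/and3P => k0 ki kj; exists (a k); first by rewrite inS // /a xpair_eqE.
by rewrite /= [i == k]eq_sym ki.
Qed.

Lemma crown_regular v : #|[set w | crown_adj v w]| = m.+3.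
Proof.
case: v => b i.
have -> : [set w | crown_adj (b, i) w] = setX [set~ b] [set~ i].
  apply/setP => -[c j]; rewrite !inE /crown_adj /=.
  by rewrite ![_ == c]eq_sym ![_ == j]eq_sym.
by rewrite cardsX !cardsC1 card_bool card_ord mul1n.
Qed.

End Crown.

Lemma crown_realizable r : 3 <= r -> realizable (2 * r + 2) r.
Proof.
case: r => [|[|[|m]]] // _.
have -> : 2 * m.+3 + 2 = #|{: bool * 'I_m.+4}|.
  by rewrite card_prod card_bool card_ord; lia.
apply: (buildable_realizable (@crown_sym m) (@crown_irr m)).
  exact: crown_buildable.
exact: crown_regular.
Qed.

(** * A cone over a cocktail party graph, with 2r + 1 vertices *)

Lemma card_setP_option (T : finType) (P : pred (option T)) :
  #|[set w | P w]| = P None + #|[set x | P (Some x)]|.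
Proof.
rewrite (cardsD1 None) inE; congr (_ + _).
rewrite -[RHS](card_imset _ (@Some_inj _)); apply: eq_card => -[x|].
  by rewrite (mem_imset _ _ (@Some_inj _)) !inE.
by rewrite !inE eqxx; apply/esym/imsetP => -[].
Qed.

Lemma card_setP_bool (T : finType) (P : pred (bool * T)) :
  #|[set w | P w]| = #|[set x | P (true, x)]| + #|[set x | P (false, x)]|.
Proof.
rewrite -!sum1dep_card -(big_bool _ (fun b => \sum_(x | P (b, x)) 1)).
by rewrite pair_big_dep; apply: eq_bigl => -[].
Qed.

Section Cone.
Variable m : nat.
Let I := 'I_m.+2.

(** The vertices (true, p) form a cocktail party graph, whose non-edges pair
    (true, (false, i)) with (true, (true, i)); the vertices (false, p) form a
    clique matched with it, and None is the apex of the cone. *)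
Definition cone_adj : rel (option (bool * (bool * I))) := fun x y =>
  match x, y with
  | Some (true, p), Some (true, q) => p.2 != q.2
  | Some (false, p), Some (false, q) => p != q
  | Some (_, p), Some (_, q) => p == q
  | None, Some (b, _) | Some (b, _), None => b
  | None, None => false
  end.

Lemma cone_sym : symmetric cone_adj.
Proof. by move=> [[[] p]|] [[[] q]|] //=; rewrite eq_sym. Qed.

Lemma cone_irr : irreflexive cone_adj.
Proof. by move=> [[[] p]|] //=; rewrite eqxx. Qed.

(** The clique comes first, so that a neighbour b of v in the clique and another
    neighbour a of v are joined through the clique vertex matched with a. The
    cocktail party graph is added with one vertex of each antipodal pair before
    the others, so that two antipodal neighbours of v are joined through the
    first vertex of the pair of v. The apex must come last, since the only
    vertex that joins it to a clique vertex is the one matched with the latter;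
    its own antipodal neighbours are joined through any other pair. *)
Lemma cone_buildable : buildable cone_adj setT.
Proof.
pose vtx := option (bool * (bool * I)).
pose a c i : vtx := Some (true, (c, i)).
pose b c i : vtx := Some (false, (c, i)).
(* The clique, then one half of the cocktail party graph, then the other. *)
pose S1 := [set x : vtx | if x is Some (c, _) then ~~ c else false].
pose S2 :=
  [set x : vtx | if x is Some (c, (d, _)) then ~~ (c && d) else false].
pose S3 := [set x : vtx | x != None].
have build1 : buildable cone_adj S1.
  apply: (buildable_grow (buildable1 _ (b false ord0))).
    by rewrite sub1set !inE.
  move=> S [[[] p]|] bS SS; rewrite inE // => _ vS.
  have {}bS : b false ord0 \in S by rewrite -sub1set.
  split; first by exists (b false ord0) => //=; apply: contraNneq vS => ->.
  move=> x y /(subsetP SS) + /(subsetP SS) + _ _.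
  by rewrite !inE; case: x => [[[] q]|] //; case: y => [[[] q']|] //= _ _ ->.
have build2 : buildable cone_adj S2.
  apply: (buildable_grow build1).
    by apply/subsetP => -[[[] [c i]]|]; rewrite !inE.
  move=> S v bS SS vU vS; have {}bS c i : b c i \in S.
    by apply: (subsetP bS); rewrite inE.
  case: v vU vS => [[[] [[] i]]|]; rewrite !inE // => _ vS;
    try by rewrite bS in vS.
  split; first by exists (b false i) => //=.
  move=> x y /(subsetP SS) + /(subsetP SS) +.
  rewrite !inE; case: x => [[[] [c j]]|] //; case: y => [[[] [d k]]|] //=.
  - case: c d => [] [] // _ _ _ _ jk.
    by rewrite negbK => /eqP e; rewrite e eqxx in jk.
  - case: c d => [] // d _ _ ij /eqP [<- <-] _ _; exists (b false j).
      exact: bS.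
    by rewrite /= eqxx xpair_eqE /= eq_sym ij.
  - case: d c => [] // c _ _ /eqP [<- <-] ik _ _; exists (b false k).
      exact: bS.
    by rewrite /= eqxx xpair_eqE /= ik.
  - by move=> _ _ /eqP <- /eqP <-; rewrite eqxx.
have build3 : buildable cone_adj S3.
  apply: (buildable_grow build2).
    by apply/subsetP => -[[[] [c i]]|]; rewrite !inE.
  move=> S v S2S SS vU vS; have bS c i : b c i \in S.
    by apply: (subsetP S2S); rewrite inE.
  have aS i : a false i \in S by apply: (subsetP S2S); rewrite inE.
  case: v vU vS => [[[] [[] i]]|]; rewrite ?inE // => _ vS;
    try by rewrite ?aS ?bS in vS.
  split; first by exists (b true i) => //=.
  move=> x y /(subsetP SS) + /(subsetP SS) +.
  rewrite !inE; case: x => [[[] [c j]]|] //; case: y => [[[] [d k]]|] //=.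
  - move=> _ _ ij ik _ _; exists (a false i); first exact: aS.
    by rewrite /= eq_sym ij ik.
  - move=> _ _ ij /eqP [<- <-] _ _; exists (b c j); rewrite ?bS //= eqxx.
    by rewrite xpair_eqE negb_and /= [j == i]eq_sym ij orbT.
  - move=> _ _ /eqP [<- <-] ik _ _; exists (b d k); rewrite ?bS //= eqxx.
    by rewrite xpair_eqE negb_and /= ik orbT.
  - by move=> _ _ /eqP <- /eqP <-; rewrite eqxx.
apply: (buildable_grow build3); first exact: subsetT.
move=> S v S3S _ _ vS; have aS i : a false i \in S.
  by apply: (subsetP S3S); rewrite inE.
case: v vS => [[c p]|] vS.
  by rewrite (subsetP S3S) ?inE in vS.
split; first by exists (a false ord0).
move=> [[[] [c j]]|] [[[] [d k]]|] //= _ _ _ _ _; rewrite negbK => /eqP <-.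
have [l lj] : exists l : I, l != j.
  exists (if j == ord0 then ord_max else ord0).
  by have [->|] := eqVneq j ord0; rewrite // eq_sym.
by exists (a false l); rewrite ?aS //= eq_sym lj.
Qed.

Lemma cone_regular v : #|[set w | cone_adj v w]| = m.+2.*2.
Proof.
rewrite card_setP_option card_setP_bool.
have cI : #|{: bool * I}| = m.+2.*2 by rewrite card_prod card_bool card_ord mul2n.
case: v => [[[] p]|] /=.
- rewrite [X in _ + (_ + X)](eq_card (B := pred1 p)); last first.
    by move=> q; rewrite !inE eq_sym.
  have -> : [set q : bool * I | p.2 != q.2] = setX [set: bool] [set~ p.2].
    by apply/setP => q; rewrite !inE /= eq_sym.
  by rewrite card1 cardsX cardsT card_bool cardsC1 card_ord; lia.
- rewrite [X in _ + (X + _)](eq_card (B := pred1 p)); last first.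
    by move=> q; rewrite !inE eq_sym.
  have -> : [set q | p != q] = [set~ p].
    by apply/setP => q; rewrite !inE /= eq_sym.
  by rewrite card1 cardsC1 cI; lia.
- rewrite (eq_card (B := predT)); last by move=> q; rewrite !inE.
  rewrite cI (eq_card (B := pred0)); last by move=> q; rewrite !inE.
  by rewrite card0 addn0.
Qed.
End Cone.

Lemma cone_realizable r : 3 < r -> ~~ odd r -> realizable (2 * r + 1) r.
Proof.
move=> r3 oddr; have [m rE] : exists m, r = m.+2.*2.
  by exists (r./2 - 2); lia.
have -> : 2 * r + 1 = #|{: option (bool * (bool * 'I_m.+2))}|.
  by rewrite card_option !card_prod card_bool card_ord rE; lia.
rewrite rE.
apply: (buildable_realizable (@cone_sym m) (@cone_irr m)).
  exact: cone_buildable.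
exact: cone_regular.
Qed.

(** * Explicit small graphs *)

Section Lists.
Variable l : seq (seq nat).

(** Each vertex lists some of its neighbours and edges are symmetrized. With only
    the smaller neighbours listed, entry v is what has to be inspected when v
    is added in the natural order. *)
Definition list_adj (i j : nat) : bool :=
  (i \in nth [::] l j) || (j \in nth [::] l i).

Definition list_attachable (v : nat) : bool :=
  let S := iota 0 v in
  has (list_adj v) S &&
  all (fun x => all (fun y => [&& list_adj v x, list_adj v y, x != y &
    ~~ list_adj x y] ==> has (fun z => list_adj x z && list_adj z y) S) S) S.

Definition list_graph_ok (r : nat) : bool :=
  all (fun v => [&& ~~ list_adj v v, count (list_adj v) (iota 0 (size l)) == r &
    (0 < v) ==> list_attachable v]) (iota 0 (size l)).

Lemma list_realizable r : 0 < size l -> list_graph_ok r ->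
  realizable (size l) r.
Proof.
move=> l0 /allP ok.
have {}ok (v : 'I_(size l)) : [/\ ~~ list_adj v v,
    count (list_adj v) (iota 0 (size l)) = r & 0 < v -> list_attachable v].
  have vl : nat_of_ord v \in iota 0 (size l) by rewrite mem_iota ltn_ord.
  by have /and3P [h1 /eqP h2 /implyP h3] := ok v vl.
pose e : rel 'I_(size l) := fun i j => list_adj i j.
have e_sym : symmetric e by move=> i j; rewrite /e /list_adj orbC.
have e_irr : irreflexive e by move=> i; have [/negbTE] := ok i.
have build k : 0 < k <= size l -> buildable e [set j : 'I_(size l) | j < k].
  elim: k => // -[_|k IH] /andP [_ kl].
    have -> : [set j : 'I_(size l) | j < 1] = [set Ordinal kl].
      by apply/setP => j; rewrite !inE -val_eqE /= ltnS leqn0.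
    exact: buildable1.
  have -> : [set j : 'I_(size l) | j < k.+2] =
      Ordinal kl |: [set j : 'I_(size l) | j < k.+1].
    by apply/setP => j; rewrite !inE -val_eqE /= ltnS leq_eqVlt.
  apply: buildableU; first by apply: IH; rewrite (ltnW kl).
    by rewrite inE /= ltnn.
  have [_ _ /(_ isT) /andP [/hasP [u uk vu] /allP h]] := ok (Ordinal kl).
  rewrite mem_iota /= in uk; split.
    by exists (Ordinal (ltn_trans uk kl)); rewrite // inE.
  move=> x y; rewrite !inE => xk yk vx vy xy exy.
  have inS (z : 'I_(size l)) : z < k.+1 -> nat_of_ord z \in iota 0 k.+1.
    by move=> zk; rewrite mem_iota.
  have /allP /(_ y (inS _ yk)) := h x (inS _ xk).
  rewrite [list_adj _ x]vx [list_adj _ y]vy [_ != _]xy exy.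
  move=> /implyP /(_ isT) /hasP [z]; rewrite mem_iota /= => zk xzy.
  by exists (Ordinal (ltn_trans zk kl)); rewrite // inE.
rewrite -[X in realizable X]card_ord.
apply: (buildable_realizable e_sym e_irr).
  have -> : setT = [set j : 'I_(size l) | j < size l].
    by apply/setP => j; rewrite !inE ltn_ord.
  by apply: build; rewrite l0 leqnn.
move=> v; have [_ <- _] := ok v.
rewrite -sum1dep_card -(big_mkord (list_adj v) (fun=> 1)) sum1_count.
by rewrite /index_iota subn0.
Qed.
End Lists.

(** * Sequences of layer sizes *)

Definition blocks (k : nat) (b : seq nat) : seq nat := flatten (nseq k b).

Lemma sumn_blocks k b : sumn (blocks k b) = k * sumn b.
Proof. by elim: k => //= k IH; rewrite sumn_cat [sumn (flatten _)]IH. Qed.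

(** A graph of degree 2r - n on r vertices, joined to n - r independent
    vertices. *)
Lemma short_realizable n r : 0 < r < n -> n <= 2 * r -> (odd r -> ~~ odd n) ->
  realizable n r.
Proof.
move=> /andP [r0 rn] n2 par; have -> : n = sumn [:: r; n - r] by rewrite /=; lia.
apply: layered_realizable => //=; rewrite !oddM !oddB; try lia.
Qed.

(** Inside the repeated block all layers are cliques, three consecutive ones
    having r + 1 vertices in total. The two outer layers are perfect matchings,
    so that y and y' have to be even; their neighbours have even size r - 1 and
    impose nothing. *)
Lemma odd_realizable r k y y' : odd r -> 1 < y < r -> 1 < y' < r ->
  ~~ odd y -> ~~ odd y' -> realizable (y + y' + (k.+1 * (r + 1) + r - 1)) r.
Proof.
move=> or hy hy' oy oy'.
pose tail := [:: r - 1; y'].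
have tailE k' : balanced r 1 (blocks k' [:: r - 1; 1; 1] ++ tail) /\
    head 0 (blocks k' [:: r - 1; 1; 1] ++ tail) = r - 1.
  elim: k' => [|k' [IH hd]] /=.
    by split => //; rewrite !oddM !oddB; lia.
  split => //; rewrite hd IH !oddM; lia.
have [bal hd] := tailE k.
have -> : y + y' + (k.+1 * (r + 1) + r - 1) =
    sumn [:: y, r - 1, 1, 1 & blocks k [:: r - 1; 1; 1] ++ tail].
  rewrite /= sumn_cat sumn_blocks /=; lia.
apply: layered_realizable => //=; rewrite hd bal !oddM; lia.
Qed.

(** As for odd r, three consecutive layers of the repeated part are cliques on
    r + 1 vertices in total. The layer of size y is 2-regular, so that y may have
    either parity as long as it is at least 3. *)
Lemma even_realizable r k y t : 5 < r -> ~~ odd r -> 2 < y < r ->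
  t \in [:: [:: r - 1]; [:: r - 2; r - 2]; [:: r - 1; r - 2]] ->
  realizable (y + k.+1 * (r + 1) + sumn t) r.
Proof.
move=> r5 er hy ht.
have tailE k' : balanced r 2 (blocks k' [:: r - 2; 1; 2] ++ t) /\
    r - 2 <= head 0 (blocks k' [:: r - 2; 1; 2] ++ t) < r.
  elim: k' => [|k' [IH hd]] /=.
    by move: ht; rewrite !inE => /or3P [] /eqP -> /=; rewrite !oddM; lia.
  move: hd; set h := head _ _ => hd; rewrite IH !oddM; lia.
have [bal hd] := tailE k.
have -> : y + k.+1 * (r + 1) + sumn t =
    sumn [:: y, r - 2, 1, 2 & blocks k [:: r - 2; 1; 2] ++ t].
  rewrite /= sumn_cat sumn_blocks /=; lia.
apply: layered_realizable => //=; rewrite bal !oddM.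
move: hd; set h := head _ _ => hd; lia.
Qed.

(** For r = 3 the ends of [odd_realizable] can only be y = y' = 2, which gives
    the residue 2 modulo 4. One extra block 2, 2, 1, 1 gives the residue 0
    from 16 on. *)
Lemma cubic_realizable n : ~~ odd n -> 10 <= n -> realizable n 3.
Proof.
move=> on n10.
have [e12|n12] := eqVneq n 12.
  (* A triangular prism with an edge of a triangle subdivided by vertex 6, and *)
  (* K_4 with an edge subdivided by vertex 7; the bridge 6-7 joins them. *)
  rewrite e12; apply: (@list_realizable [:: [::]; [:: 0]; [:: 1]; [:: 1; 2];
    [:: 0; 2]; [:: 3; 4]; [:: 0; 5]; [:: 6]; [:: 7]; [:: 8]; [:: 7; 9];
    [:: 8; 9; 10]]) => //.
have [k [kE|kE]] : exists k, n = 10 + 4 * k \/ n = 16 + 4 * k.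
  by exists ((n - 10) %/ 4 - (n %% 4 == 0)); lia.
- suff -> : n = 2 + 2 + (k.+1 * (3 + 1) + 3 - 1) by apply: odd_realizable.
  lia.
have tailE k' : balanced 3 1 (blocks k' [:: 2; 1; 1] ++ [:: 2; 2]) /\
    head 0 (blocks k' [:: 2; 1; 1] ++ [:: 2; 2]) = 2.
  by elim: k' => //= k' [-> ->].
have [bal hd] := tailE k.
have -> : n =
    sumn [:: 2, 2, 1, 1, 2, 2, 1, 1 & blocks k [:: 2; 1; 1] ++ [:: 2; 2]].
  rewrite /= sumn_cat sumn_blocks /=; lia.
by apply: layered_realizable => //=; rewrite hd bal.
Qed.

(** Between two layers of size 1, two or more layers of size 2 can be inserted
    at will, so that one pair of ends for each parity gives all large n. The
    lists for 12, 14 and 17 have at one end an octahedron with an edge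
    subdivided, whose 7 vertices change the parity. *)
Lemma quartic_realizable n : 11 <= n -> realizable n 4.
Proof.
move=> n11.
have special s : 1 < size s -> balanced 4 0 s -> n = sumn s -> realizable n 4.
  by move=> ? ? ->; apply: layered_realizable.
have long k s : balanced 4 2 [:: 2, 1 & s] ->
    n = sumn s + (2 * k + 11) -> realizable n 4.
  move=> bs nE.
  apply: (special ([:: 3; 2; 1; 2] ++ blocks k [:: 2] ++ [:: 2, 1 & s])) => //.
    have -> : balanced 4 0 ([:: 3; 2; 1; 2] ++ blocks k [:: 2] ++ [:: 2, 1 & s]) =
        balanced 4 2 (blocks k [:: 2] ++ [:: 2, 1 & s]) by case: k {nE}.
    by elim: k {nE} => //= k ->; case: k.
  by rewrite nE !sumn_cat sumn_blocks /=; lia.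
have [e12|n12] := eqVneq n 12.
  (* K_5 and the octahedron, each with one edge subdivided, share vertex 5. *)
  rewrite e12; apply: (@list_realizable [:: [::]; [:: 0]; [:: 0; 1]; [:: 0; 1; 2];
    [:: 1; 2; 3]; [:: 0; 4]; [:: 5]; [:: 6]; [:: 5; 7]; [:: 6; 8]; [:: 7; 8; 9];
    [:: 6; 7; 9; 10]]) => //.
have [e14|n14] := eqVneq n 14.
  (* Layers 2, 3, 2, 1, then the subdivided octahedron from the cut vertex 7. *)
  rewrite e14; apply: (@list_realizable [:: [::]; [:: 0]; [:: 0; 1]; [:: 1; 2];
    [:: 1; 2]; [:: 0; 3; 4]; [:: 0; 3; 4]; [:: 5; 6]; [:: 7]; [:: 8]; [:: 7; 9];
    [:: 8; 10]; [:: 9; 10; 11]; [:: 8; 9; 11; 12]]) => //.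
have [e17|n17] := eqVneq n 17.
  (* Layers 3, 2, 1, 2, 2, 1, then the subdivided octahedron from vertex 10. *)
  rewrite e17; apply: (@list_realizable [:: [::]; [:: 0]; [:: 0; 1]; [:: 0; 1; 2];
    [:: 1; 2; 3]; [:: 0; 4]; [:: 5]; [:: 5; 6]; [:: 6; 7]; [:: 6; 7; 8]; [:: 8; 9];
    [:: 10]; [:: 11]; [:: 10; 12]; [:: 11; 13]; [:: 12; 13; 14];
    [:: 11; 12; 14; 15]]) => //.
have [e11|n11'] := eqVneq n 11; first exact: (special [:: 3; 2; 1; 2; 3]).
have [e13|n13] := eqVneq n 13; first exact: (special [:: 2; 3; 2; 1; 2; 3]).
have [e15|n15] := eqVneq n 15; first exact: (special [:: 2; 3; 2; 1; 2; 3; 2]).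
have [e19|n19] := eqVneq n 19.
  exact: (special [:: 3; 2; 1; 2; 3; 2; 1; 2; 3]).
have [on|en] := boolP (odd n).
  by apply: (@long ((n - 21)./2) [:: 2; 2; 1; 2; 3]) => //=; lia.
by apply: (@long ((n - 16)./2) [:: 2; 3]) => //=; lia.
Qed.

(** * All admissible pairs *)

Theorem theorem2p2 (n r : nat) (hnr : admissible n r) :
  exists G : graph, [/\ #|G| = n, distance_preserving G & regular G r].
Proof.
rewrite -/(realizable n r); case: hnr => _ r0 r3 rn par.
have [n2r|n2r] := leqP n (2 * r); first by apply: short_realizable => //; lia.
have [e2|n2] := eqVneq n (2 * r + 2).
  by rewrite e2; apply: crown_realizable.
have [or|er] := boolP (odd r).
  have on := par or.
  have [e3|r5] := eqVneq r 3.
    by rewrite e3 in n2r n2 *; apply: cubic_realizable => //; lia.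
  (* The block count is q + 1; the remainder d is shared among y - 2 and y' - 2, *)
  (* each of which is at most r - 3. *)
  pose q := (n - (2 * r + 4)) %/ (r + 1); pose d := (n - (2 * r + 4)) %% (r + 1).
  have nE : n = q * (r + 1) + d + (2 * r + 4) by rewrite -divn_eq; lia.
  have dr : d < r + 1 by rewrite ltn_mod addn1.
  have od : ~~ odd d.
    by move: on; rewrite nE !oddD oddM oddD or andbF /= addbF.
  have [dl|dl] := leqP d (r - 3).
    have -> : n = d.+2 + 2 + (q.+1 * (r + 1) + r - 1) by lia.
    by apply: odd_realizable => //=; lia.
  have -> : n = (r - 1) + 4 + (q.+1 * (r + 1) + r - 1) by lia.
  by apply: odd_realizable => //=; lia.
have [e1|n1] := eqVneq n (2 * r + 1).
  by rewrite e1; apply: cone_realizable => //; lia.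
have [e4|r4] := eqVneq r 4.
  by rewrite e4 in n2r n2 n1 *; apply: quartic_realizable; lia.
(* The first end reaches the remainders up to r - 4, the second one r - 3, and *)
(* the third one r - 2, r - 1 and r with y = 3, 4 and 5. *)
pose q := (n - (2 * r + 3)) %/ (r + 1); pose d := (n - (2 * r + 3)) %% (r + 1).
have nE : n = q * (r + 1) + d + (2 * r + 3) by rewrite -divn_eq; lia.
have dr : d < r + 1 by rewrite ltn_mod addn1.
have [dl|dl] := leqP d (r - 4).
  have -> : n = (d + 3) + q.+1 * (r + 1) + sumn [:: r - 1] by rewrite /=; lia.
  by apply: even_realizable; rewrite ?inE ?eqxx ?orbT //; lia.
have [de|de] := eqVneq d (r - 3).
  have -> : n = 3 + q.+1 * (r + 1) + sumn [:: r - 2; r - 2] by rewrite /=; lia.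
  by apply: even_realizable; rewrite ?inE ?eqxx ?orbT //; lia.
have -> : n = (d + 5 - r) + q.+1 * (r + 1) + sumn [:: r - 1; r - 2].
  by rewrite /=; lia.
by apply: even_realizable; rewrite ?inE ?eqxx ?orbT //; lia.
Qed.
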